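(* For every integer $n\ge 0$, $c_{10}(n)$ is odd if $n=2j^2+j$ for some $j\in\mathbb{Z}$, and $c_{10}(n)$ is even otherwise.
   Context: A partition of $n\ge 0$ is a finite multiset of positive integers summing to $n$; the empty partition is the partition of $0$. For $n\ge 0$, $c_{10}(n)$ denotes the number of partitions $\lambda$ of $n$ such that either (a) all parts of $\lambda$ are distinct, or (b) there is an integer $j\ge 1$ such that: every odd integer $\le j$ appears exactly two or three times; every odd part greater than $j$ appears at most once; every even integer $\le j$ appears exactly twice; no even part lies in the interval $(j,2j]$; and every even part greater than $2j$ appears at most once. *)

(* Defs.v *)
From mathcomp Require Import all_boot all_order all_algebra.
From mathcomp Require Import boolp.
Set Implicit Arguments. Unset Strict Implicit. Unset Printing Implicit Defensive.

(* A partition of n is encoded by its multiplicity function: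
   m : {ffun 'I_n.+1 -> 'I_n.+1}, where m k is the number of times the part k
   occurs.  Every part of a partition of n is <= n and occurs at most n times,
   so this encoding is a bijection with finite multisets of positive integers
   summing to n (part 0 is forbidden: m 0 = 0). *)
Definition ptn (n : nat) := {ffun 'I_n.+1 -> 'I_n.+1}.

Definition mult (n : nat) (m : ptn n) (k : nat) : nat :=
  if insub k is Some i then nat_of_ord (m i) else 0.

Definition is_partition (n : nat) (m : ptn n) : bool :=
  (mult m 0 == 0) && (\sum_(i < n.+1) i * m i == n).

Definition distinct_parts (n : nat) (m : ptn n) : Prop :=
  forall k, mult m k <= 1.

Definition cond_b (n : nat) (m : ptn n) : Prop :=
  exists j : nat, 1 <= j /\
    forall k : nat, 1 <= k ->
      [/\ (odd k -> k <= j -> mult m k = 2 \/ mult m k = 3),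
          (odd k -> j < k -> mult m k <= 1),
          (~~ odd k -> k <= j -> mult m k = 2),
          (~~ odd k -> j < k <= j.*2 -> mult m k = 0)
        & (~~ odd k -> j.*2 < k -> mult m k <= 1)].

Definition c10 (n : nat) : nat :=
  #|[set m : ptn n | is_partition m && `[< distinct_parts m \/ cond_b m >]]|.

(* Main.v *)
Require Import Defs.
From mathcomp Require Import all_boot all_order all_algebra.
From mathcomp Require Import boolp zify ring.
Set Implicit Arguments. Unset Strict Implicit. Unset Printing Implicit Defensive.
Import Order.TTheory GRing.Theory Num.Theory.
Local Open Scope ring_scope.

(** Sorting the partitions by [j] (with [j = 0] for distinct parts), the
    generating function of [c10] is
      (-q; q^2)_oo * sum_j q^(j(j+1)) (-q^(2j+2); q^2)_oo.
    Modulo 2 the signs are irrelevant, and with Q = q^2 Euler's identity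
    sum_j Q^(j(j+1)/2) / (Q; Q)_j = (-Q; Q)_oo turns the sum into
    (Q; Q)_oo (-Q; Q)_oo = (q^4; q^4)_oo. By the Jacobi triple product,
    (-q; q^2)_oo (q^4; q^4)_oo = sum_(t in Z) q^(2 t^2 + t).
    Both identities are derived from the finite q-binomial theorem, and power
    series are replaced by polynomials modulo 'X^(n+1). *)

(** * Gaussian binomials and the finite q-binomial theorem *)

Section GaussianBinomial.
Variables (R : comNzRingType) (q : R).

Definition qpoch (m : nat) : R := \prod_(0 <= i < m) (1 - q ^+ i.+1).

Fixpoint gbin (m j : nat) : R :=
  match m, j with
  | _, 0 => 1
  | 0, _.+1 => 0
  | m'.+1, j'.+1 => gbin m' j'.+1 + q ^+ (m' - j') * gbin m' j'
  end.

Lemma gbin0 m : gbin m 0 = 1.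
Proof. by case: m. Qed.

Lemma gbinS m j :
  gbin m.+1 j.+1 = gbin m j.+1 + q ^+ (m - j) * gbin m j.
Proof. by []. Qed.

Lemma gbin_small m j : (m < j)%N -> gbin m j = 0.
Proof.
elim: m j => [|m IHm] [|j] //= ltmj.
by rewrite !IHm ?mulr0 ?addr0 //; lia.
Qed.

Lemma qpochS m : qpoch m.+1 = qpoch m * (1 - q ^+ m.+1).
Proof. by rewrite /qpoch big_nat_recr. Qed.

Lemma qpoch0 : qpoch 0 = 1.
Proof. by rewrite /qpoch big_nil. Qed.

Lemma qpoch_cat m j : (j <= m)%N ->
  qpoch m = qpoch j * \prod_(j <= i < m) (1 - q ^+ i.+1).
Proof. by move=> lejm; rewrite /qpoch (big_cat_nat _ lejm). Qed.

(** Division-free quotient formula, by induction on [a + b]. The two Pascal terms recombine because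
    (1 - q^(b+1)) + q^(b+1) (1 - q^(a+1)) = 1 - q^(a+b+2). *)
Lemma gbin_qpoch a b : gbin (a + b) a * qpoch a * qpoch b = qpoch (a + b).
Proof.
have [s] := ubnP (a + b); elim: s a b => // s IHs [|a] [|b] lt_s.
- by rewrite gbin0 qpoch0 !mulr1.
- by rewrite gbin0 qpoch0 !mul1r.
- rewrite addn0 qpoch0 mulr1 gbinS gbin_small // add0r subnn mul1r.
  have := IHs a 0%N; rewrite addn0 qpoch0 mulr1 => IHa.
  by rewrite qpochS mulrA IHa //; lia.
have IH1 := IHs a.+1 b; have IH2 := IHs a b.+1.
rewrite addSn gbinS addnS -addSn.
rewrite -addSnnS in IH2.
rewrite (_ : a.+1 + b - a = b.+1)%N; last lia.
have -> : (gbin (a.+1 + b) a.+1 + q ^+ b.+1 * gbin (a.+1 + b) a)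
    * qpoch a.+1 * qpoch b.+1 =
  gbin (a.+1 + b) a.+1 * qpoch a.+1 * qpoch b * (1 - q ^+ b.+1) +
  gbin (a.+1 + b) a * qpoch a * qpoch b.+1 * (q ^+ b.+1 * (1 - q ^+ a.+1)).
  by rewrite !qpochS; ring.
rewrite IH1 ?IH2; [|lia..].
rewrite qpochS (_ : (a.+1 + b).+1 = a.+1 + b.+1)%N; last lia.
by rewrite exprD; ring.
Qed.

(** Induction on [m], multiplying by the last factor and using the q-Pascal rule. The homogeneous
    form lets [y] be a power of [q] or of the indeterminate, which avoids negative exponents in the
    triple product. *)
Lemma qbinomial (x y : R) m :
  \prod_(i < m) (y + x * q ^+ i) =
  \sum_(j < m.+1) gbin m j * q ^+ 'C(j, 2) * x ^+ j * y ^+ (m - j).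
Proof.
elim: m => [|m IHm].
  by rewrite big_ord0 big_ord_recl big_ord0 /= !mulr1 addr0.
rewrite big_ord_recr /= IHm [RHS]big_ord_recl /= !mul1r.
under [X in _ = _ + X]eq_bigr => j _.
  rewrite mulrDl mulrDl mulrDl; over.
rewrite big_split /= addrA mulrDr; congr (_ + _).
  rewrite big_ord_recl big_ord_recr /= /bump /= gbin0.
  rewrite gbin_small ?ltnS // !mul0r addr0 !mul1r !subn0.
  rewrite mulrDl -exprSr; congr (_ + _).
  rewrite mulr_suml; apply: eq_bigr => j _.
  rewrite -mulrA -exprSr /= (_ : (m - (1 + j)).+1 = m.+1 - (1 + j))%N //.
  by have := ltn_ord j; lia.
rewrite mulr_suml; apply: eq_bigr => j _.
rewrite /bump /= add1n subSS exprS binS bin1 exprD.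
have -> : q ^+ m = q ^+ (m - j) * q ^+ j.
  by rewrite -exprD subnK // -ltnS.
by ring.
Qed.

End GaussianBinomial.

(** * Polynomial congruences modulo a power of X *)

Section Congruence.
Variables (F : fieldType) (N : nat).
Implicit Types p r : {poly F}.

Definition eqmX p r := 'X^N %| p - r.

Lemma eqmX_refl p : eqmX p p.
Proof. by rewrite /eqmX subrr dvdp0. Qed.

Lemma eqmX_sym p r : eqmX p r -> eqmX r p.
Proof. by rewrite /eqmX -opprB dvdpNr. Qed.

Lemma eqmX_trans r p s : eqmX p r -> eqmX r s -> eqmX p s.
Proof.
move=> pr rs; have eq_ps : p - s = (p - r) + (r - s) by ring.
by rewrite /eqmX eq_ps; apply: dvdp_add.
Qed.

Lemma eqmXD p1 r1 p2 r2 : eqmX p1 r1 -> eqmX p2 r2 -> eqmX (p1 + p2) (r1 + r2).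
Proof. by move=> h1 h2; rewrite /eqmX opprD addrACA; apply: dvdp_add. Qed.

Lemma eqmXM p1 r1 p2 r2 : eqmX p1 r1 -> eqmX p2 r2 -> eqmX (p1 * p2) (r1 * r2).
Proof.
move=> h1 h2; rewrite /eqmX.
have -> : p1 * p2 - r1 * r2 = (p1 - r1) * p2 + r1 * (p2 - r2) by ring.
by apply: dvdp_add; [apply: dvdp_mulr|apply: dvdp_mull].
Qed.

Lemma eqmX_sum (I : Type) (s : seq I) (P : pred I) (f g : I -> {poly F}) :
  (forall i, P i -> eqmX (f i) (g i)) ->
  eqmX (\sum_(i <- s | P i) f i) (\sum_(i <- s | P i) g i).
Proof.
by move=> h; apply: (big_ind2 eqmX) => //; [exact: eqmX_refl|exact: eqmXD].
Qed.

Lemma eqmX_prod (I : Type) (s : seq I) (P : pred I) (f g : I -> {poly F}) :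
  (forall i, P i -> eqmX (f i) (g i)) ->
  eqmX (\prod_(i <- s | P i) f i) (\prod_(i <- s | P i) g i).
Proof.
by move=> h; apply: (big_ind2 eqmX) => //; [exact: eqmX_refl|exact: eqmXM].
Qed.

Lemma eqmX_coef p r i : eqmX p r -> (i < N)%N -> p`_i = r`_i.
Proof.
move=> /dvdpP[s eqs] ltiN; apply/eqP; rewrite -subr_eq0 -coefB eqs.
by rewrite coefMXn ltiN.
Qed.

Lemma eqmX_Xn0 e p : (N <= e)%N -> eqmX (p * 'X^e) 0.
Proof. by move=> leNe; rewrite /eqmX subr0 dvdp_mull // dvdp_exp2l. Qed.

Lemma eqmX_1BXn e : (N <= e)%N -> eqmX (1 - 'X^e) 1.
Proof.
move=> leNe; apply: eqmX_sym.
by rewrite /eqmX opprB addrCA subrr addr0 dvdp_exp2l.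
Qed.

(** A nonzero constant term makes [p] coprime to X, hence to ['X^N]. *)
Lemma eqmX_cancel p r s : p`_0 != 0 -> eqmX (p * r) (p * s) -> eqmX r s.
Proof.
move=> p0; rewrite /eqmX -mulrBr Gauss_dvdpr // coprimep_expl //.
by rewrite coprimep_sym -['X]subr0 coprimep_XsubC rootE horner_coef0.
Qed.

End Congruence.

(** * Truncated forms of the Jacobi triple product and Euler's identity *)

Lemma double_bin2 j : ('C(j, 2) * 2 = j * j.-1)%N.
Proof.
elim: j => // j IHj.
by rewrite binS bin1 mulnDl IHj; case: j {IHj} => //= j; lia.
Qed.

(* [2 t ^ 2 + t] at [t = j - M], which may be negative. *)
Definition jtp_exp (M j : nat) : nat :=
  (if M <= j then 2 * (j - M) ^ 2 + (j - M) else (M - j) * (2 * (M - j)).-1)%N.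

Section PowerSeries.
Variable F : fieldType.
Implicit Types N M K : nat.

(** The q-binomial theorem with base ['X^4] and an even number of factors, read symmetrically around
    the middle term. *)
Lemma finite_triple_product M :
  \prod_(i < M) ((1 + 'X^(4 * i + 1)) * (1 + 'X^(4 * i + 3))) =
  \sum_(j < (M + M).+1) gbin 'X^4 (M + M) j * 'X^(jtp_exp M j) :> {poly F}.
Proof.
case: M => [|M].
  by rewrite big_ord0 big_ord_recl big_ord0 /= addr0 mul1r /jtp_exp.
have := qbinomial ('X^4 : {poly F}) 1 'X^(4 * M + 1) (M.+1 + M.+1).
(* Reversing the lower half pairs index [M - i] with [M.+1 + i]. Each pair releases a monomial;
   together these give ['X^c], cancelled below. *)
rewrite big_split_ord /= (reindex_inj rev_ord_inj) /= -big_split /=.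
pose c := (M.+1 * (6 * M).+1)%N.
have sumE : (\sum_(i < M.+1) (4 * (M - i) + (4 * M + 1)) = c)%N.
  rewrite big_split /= sum_nat_const card_ord.
  rewrite (reindex_inj rev_ord_inj) /=.
  under eq_bigr => i _ do rewrite subSS (subKn (leq_ord i)).
  rewrite (_ : \sum_(i < M.+1) 4 * i = 2 * M * M.+1)%N; first by rewrite /c; lia.
  by elim: (M) => [|m IHm]; rewrite big_ord_recr /= ?big_ord0 ?IHm; lia.
under eq_bigr => i _.
  have leiM : (i <= M)%N by rewrite -ltnS.
  rewrite subSS !mul1r -!exprM.
  have -> : ('X^(4 * M + 1) + 'X^(4 * (M - i))) *
      ('X^(4 * M + 1) + 'X^(4 * (M.+1 + i))) =
    'X^(4 * (M - i) + (4 * M + 1)) *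
      ((1 + 'X^(4 * i + 1)) * (1 + 'X^(4 * i + 3))) :> {poly F}.
    have -> : (4 * (M.+1 + i) = 4 * M + 1 + (4 * i + 3))%N by lia.
    have {1}-> : (4 * M + 1 = 4 * (M - i) + (4 * i + 1))%N by lia.
    by rewrite !(exprD _ (4 * (M - i))) (exprD _ (4 * M + 1)); ring.
  over.
rewrite big_split /= -expr_sum sumE => eqX.
have Xc0 : 'X^c != 0 :> {poly F} by rewrite expf_neq0 ?polyX_eq0.
apply: (mulfI Xc0); rewrite eqX mulr_sumr; apply: eq_bigr => j _.
rewrite expr1n mulr1 -!exprM -mulrA [RHS]mulrCA -!exprD; congr (_ * 'X^_).
(* What remains is 4 C(j,2) + (4M+1)(2M+2-j) = c + [jtp_exp M.+1 j], checked by the sign of j -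
   (M+1). *)
have := double_bin2 j; have := ltn_ord j; rewrite /c /jtp_exp.
move: (nat_of_ord j) => {}j; move: 'C(j, 2) => b ltj eqb.
case: leqP => [ltjM|leMj].
  have eqj : M.+1 = (j + (M.+1 - j))%N by lia.
  have -> : (M.+1 + M.+1 - j = M.+1 + (M.+1 - j))%N by lia.
  by move: (M.+1 - j)%N eqj => s eqj; nia.
have eqj : j = (M.+1 + (j - M.+1))%N by lia.
have -> : (M.+1 + M.+1 - j = M.+1 - (j - M.+1))%N by lia.
have : (j - M.+1 <= M.+1)%N by lia.
by move: (j - M.+1)%N eqj => t eqj letM; subst j; nia.
Qed.

Lemma qpoch_coef0 d K : (0 < d)%N -> (qpoch ('X^d : {poly F}) K)`_0 = 1.
Proof.
move=> d0; rewrite /qpoch coef0_prod big1 // => i _.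
by rewrite coefB coef1 eqxx -exprM coefXn eq_sym muln_eq0 eqn0Ngt d0 subr0.
Qed.

Lemma eqmX_prod_1B N a b d : (0 < d)%N -> (N <= a)%N ->
  eqmX N (\prod_(a <= i < b) (1 - 'X^d ^+ i.+1) : {poly F}) 1.
Proof.
move=> d0 leNa.
rewrite -[X in eqmX _ _ X](@big1_eq _ 1 *%R nat (index_iota a b) xpredT).
rewrite !big_nat; apply: eqmX_prod => i ltaib.
by rewrite -exprM; apply: eqmX_1BXn; nia.
Qed.

Lemma qpoch_eqmX N d K : (0 < d)%N -> (N <= K)%N ->
  eqmX N (qpoch ('X^d : {poly F}) K) (qpoch 'X^d N).
Proof.
move=> d0 leNK; rewrite (qpoch_cat _ leNK) -[X in eqmX _ _ X]mulr1.
by apply: eqmXM; [exact: eqmX_refl|exact: eqmX_prod_1B].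
Qed.

(** All the products [qpoch] of length at least [N] agree modulo ['X^N], so [gbin_qpoch] reads G P P
    = P there, and one P cancels. *)
Lemma gbin_qpoch_eqmX N d a b K :
  (0 < d)%N -> (N <= a)%N -> (N <= b)%N -> (N <= K)%N ->
  eqmX N (gbin ('X^d : {poly F}) (a + b) a * qpoch 'X^d K) 1.
Proof.
move=> d0 lea leb leK; set G := gbin _ _ _; set P := qpoch ('X^d : {poly F}) N.
have GP : eqmX N (G * P) 1.
  apply: (@eqmX_cancel _ _ P); first by rewrite qpoch_coef0 // oner_neq0.
  rewrite mulr1 mulrCA mulrA.
  apply: (@eqmX_trans _ _ (qpoch 'X^d (a + b))); last first.
    by apply: qpoch_eqmX => //; lia.
  rewrite -gbin_qpoch -/G; apply: eqmXM; last exact/eqmX_sym/qpoch_eqmX.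
  by apply: eqmXM; [exact: eqmX_refl|exact/eqmX_sym/qpoch_eqmX].
apply: eqmX_trans GP.
by apply: eqmXM; [exact: eqmX_refl|exact: qpoch_eqmX].
Qed.

Lemma triple_product_eqmX N M K : (N <= K)%N -> (N.*2 <= M)%N ->
  eqmX N (qpoch ('X^4 : {poly F}) K *
          \prod_(i < M) ((1 + 'X^(4 * i + 1)) * (1 + 'X^(4 * i + 3))))
    (\sum_(j < (M + M).+1) 'X^(jtp_exp M j)).
Proof.
move=> leNK leNM; rewrite finite_triple_product mulr_sumr.
apply: eqmX_sum => j _; rewrite mulrA [_ * gbin _ _ _]mulrC.
have ltj := ltn_ord j.
have [/andP[leNj lejN]|far] := boolP ((N <= j) && (j + N <= M + M))%N.
  rewrite -[X in eqmX _ _ X]mul1r; apply: eqmXM; last exact: eqmX_refl.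
  have := @gbin_qpoch_eqmX N 4 j (M + M - j) K isT.
  by rewrite subnKC -1?ltnS //; apply => //; lia.
(* Away from the centre |j - M| is at least [N], and 2t^2 + t is at least |t| for integral t, so
   both sides vanish modulo ['X^N]. *)
have leNe : (N <= jtp_exp M j)%N.
  rewrite /jtp_exp; case: (leqP M j) => leMj.
    by apply: leq_trans (leq_addl _ _); lia.
  by apply: (@leq_trans (M - j)); [lia|apply: leq_pmulr; lia].
apply: (eqmX_trans (eqmX_Xn0 _ leNe)); apply: eqmX_sym.
by rewrite -[X in eqmX _ X]mul1r; apply: eqmX_Xn0.
Qed.

Lemma qpoch_neq0 d K : (0 < d)%N -> qpoch ('X^d : {poly F}) K != 0.
Proof.
move=> d0; apply/eqP => eq0; have := qpoch_coef0 K d0.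
by rewrite eq0 coef0 => /eqP; rewrite eq_sym oner_eq0.
Qed.

(** Euler's identity with denominators cleared: expand the first product on the right by the
    q-binomial theorem and multiply by [qpoch]. Terms with j at least [N] vanish modulo ['X^N]. *)
Lemma sum_qpoch_tail_eqmX N M d : (0 < d)%N -> (N.*2 <= M)%N ->
  eqmX N (\sum_(j < N) 'X^d ^+ 'C(j.+1, 2) *
                         \prod_(j <= i < M) (1 - 'X^d ^+ i.+1))
         (\prod_(i < M) (1 + 'X^d ^+ i.+1) * qpoch ('X^d : {poly F}) M).
Proof.
move=> d0 leNM; set q : {poly F} := 'X^d.
have -> : \prod_(i < M) (1 + q ^+ i.+1) =
    \sum_(j < M.+1) gbin q M j * q ^+ 'C(j.+1, 2).
  have := qbinomial q q 1 M.
  under eq_bigr => i _ do rewrite -exprS.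
  move=> ->; apply: eq_bigr => j _.
  by rewrite expr1n mulr1 -mulrA -exprD binS bin1 addnC.
rewrite mulr_suml.
rewrite -(big_mkord xpredT (fun j => q ^+ 'C(j.+1, 2) *
                                     \prod_(j <= i < M) (1 - q ^+ i.+1))).
rewrite -(big_mkord xpredT (fun j => gbin q M j * q ^+ 'C(j.+1, 2) * qpoch q M)).
have leNM1 : (N <= M.+1)%N by lia.
rewrite (big_cat_nat _ leNM1) //= -[X in eqmX _ X]addr0.
apply: eqmXD; last first.
  apply: eqmX_sym.
  rewrite -[X in eqmX _ _ X](@big1_eq _ 0 +%R nat (index_iota N M.+1) xpredT).
  rewrite !big_nat; apply: eqmX_sum => j ltj.
  rewrite mulrAC -exprM; apply: eqmX_Xn0.
  by have := double_bin2 j.+1; nia.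
rewrite !big_nat; apply: eqmX_sum => j /andP[_ ltjN].
have lejM : (j <= M)%N by lia.
have eqG : gbin q M j * qpoch q (M - j) = \prod_(j <= i < M) (1 - q ^+ i.+1).
  apply: (mulfI (qpoch_neq0 j d0)); rewrite -(qpoch_cat _ lejM) mulrA.
  by rewrite [_ * gbin _ _ _]mulrC -{1 3}(subnKC lejM) gbin_qpoch subnKC.
(* The leftover product starts at [M - j], which is at least [N], so it is congruent to 1. *)
have -> : gbin q M j * q ^+ 'C(j.+1, 2) * qpoch q M =
    q ^+ 'C(j.+1, 2) * \prod_(j <= i < M) (1 - q ^+ i.+1) *
    \prod_(M - j <= i < M) (1 - q ^+ i.+1).
  by rewrite (qpoch_cat q (leq_subr j M)) -eqG; ring.
apply: eqmX_sym; rewrite -[X in eqmX _ _ X]mulr1.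
by apply: eqmXM; [exact: eqmX_refl|apply: eqmX_prod_1B => //; lia].
Qed.

Lemma prod_1D_qpoch (q : {poly F}) M :
  \prod_(i < M) (1 + q ^+ i.+1) * qpoch q M = qpoch (q ^+ 2) M.
Proof.
rewrite /qpoch !big_mkord -big_split /=; apply: eq_bigr => i _.
by rewrite -exprM mulnC exprM; ring.
Qed.

End PowerSeries.

(* [allowed j k a]: the part [k] may occur [a] times in a partition satisfying
   condition (b) with parameter [j]; [j = 0] describes distinct parts. *)
Definition allowed (j k a : nat) : bool :=
  if k == 0%N then a == 0%N
  else if (k <= j)%N then (a == 2) || odd k && (a == 3)
  else if odd k || (j.*2 < k)%N then (a <= 1)%N else a == 0%N.

(** * Sorting partitions by [j] and counting them by a coefficient *)

Section Partitions.
Variable n : nat.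
Implicit Type m : ptn n.

Definition allowed_ptn (j : nat) m := [forall k : 'I_n.+1, allowed j k (m k)].

Lemma multE m (k : 'I_n.+1) : mult m k = m k.
Proof. by rewrite /mult valK. Qed.

Lemma mult_gt m k : (n < k)%N -> mult m k = 0%N.
Proof. by move=> ltnk; rewrite /mult insubF // ltnS leqNgt ltnk. Qed.

Lemma allowed_ptnP j m : (j <= n)%N ->
  reflect (forall k, allowed j k (mult m k)) (allowed_ptn j m).
Proof.
move=> lejn; apply: (iffP forallP) => [al k|al k]; last by rewrite -multE.
have [lekn|ltnk] := leqP k n.
  by have := al (inord k); rewrite -multE inordK.
(* A part above [n] has multiplicity 0, which is allowed because it also exceeds [j]. *)
rewrite mult_gt // /allowed; case: ifP => // _.
by rewrite leqNgt (leq_ltn_trans lejn ltnk) /= if_same.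
Qed.

Lemma allowed0P m :
  reflect (mult m 0 = 0%N /\ distinct_parts m) (allowed_ptn 0 m).
Proof.
apply: (iffP (allowed_ptnP _ (leq0n n))) => [al|[m0 dm] k].
  split; first by apply/eqP/(al 0%N).
  move=> k; have := al k; rewrite /allowed; case: k => [/eqP->//|k] /=.
  by rewrite orbT.
by rewrite /allowed; case: k => [|k] /=; rewrite ?m0 ?orbT ?dm.
Qed.

Lemma allowed_cond_bP j m : (mult m 0 = 0%N /\
  forall k : nat, (1 <= k)%N ->
      [/\ (odd k -> (k <= j)%N -> mult m k = 2 \/ mult m k = 3),
          (odd k -> (j < k)%N -> (mult m k <= 1)%N),
          (~~ odd k -> (k <= j)%N -> mult m k = 2),
          (~~ odd k -> (j < k <= j.*2)%N -> mult m k = 0%N)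
        & (~~ odd k -> (j.*2 < k)%N -> (mult m k <= 1)%N)]) <->
  forall k, allowed j k (mult m k).
Proof.
split=> [[m0 cb] k|al].
  rewrite /allowed; case: k => [|k]; first by rewrite m0.
  have [//|c1 c2 c3 c4 c5] := cb k.+1; rewrite [k.+1 == _]/=.
  have [lekj|ltjk] := leqP k.+1 j.
    case: (boolP (odd k.+1)) => ok; last by rewrite c3.
    by case: (c1 ok lekj) => ->.
  case: (boolP (odd k.+1)) => ok; first exact: c2.
  have [ltk|lek] /= := ltnP j.*2 k.+1; first exact: c5.
  by rewrite c4 // ltjk.
split; first by apply/eqP/(al 0%N).
move=> [//|k] _; have := al k.+1; rewrite /allowed [k.+1 == _]/=.
have [lekj|ltjk] := leqP k.+1 j; case: (boolP (odd k.+1)) => ok.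
- by move=> /orP[/eqP->|/eqP->]; split => //; by [left|right|lia].
- by rewrite orbF => /eqP->; split => //; lia.
- by move=> le1; split.
have [ltk|lek] /= := ltnP j.*2 k.+1; first by move=> le1; split => //; lia.
by move=> /eqP->; split.
Qed.

(** For i < j, the part i + 1 would occur at most once by [i] and at least twice by [j]. Hence the
    classes are disjoint and their sizes add up. *)
Lemma allowed_ptn_inj i j m : (i <= n)%N -> (j <= n)%N ->
  allowed_ptn i m -> allowed_ptn j m -> i = j.
Proof.
wlog ltij : i j / (i < j)%N => [hw|] lein lejn ali alj.
  by have [lt|lt|//] := ltngtP i j; [exact: hw|apply/esym/hw].
move: ali alj => /allowed_ptnP-/(_ lein i.+1) + /allowed_ptnP-/(_ lejn i.+1).
by rewrite /allowed /= ltnn ltij; case: (odd _); case: (_ < _)%N => /=; lia.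
Qed.

Lemma exists_allowed m : is_partition m ->
  `[< distinct_parts m \/ cond_b m >] = [exists j : 'I_n.+1, allowed_ptn j m].
Proof.
move=> /andP[/eqP m0 _]; apply/asboolP/existsP => [[dm|[j [j0 cb]]]|[j]].
- by exists ord0; apply/allowed0P.
(* The part [j] itself must occur, so it cannot exceed [n]. *)
- have lejn : (j <= n)%N.
    rewrite leqNgt; apply/negP => ltnj.
    have [c1 _ c3 _ _] := cb j j0; have m_j := mult_gt m ltnj.
    have [oj|oj] := boolP (odd j).
      by have := c1 oj (leqnn j); rewrite m_j; case.
    by have := c3 oj (leqnn j); rewrite m_j.
  exists (Ordinal (lejn : (j < n.+1)%N)); apply/allowed_ptnP => //.
  exact/allowed_cond_bP.
case: j => [[|j] ltjn] /=; first by move=> /allowed0P[_ dm]; left.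
move=> /allowed_ptnP-/(_ ltjn)/allowed_cond_bP[_ cb].
by right; exists j.+1.
Qed.

Lemma c10_sum_allowed :
  c10 n = (\sum_(j < n.+1) #|[set m : ptn n | is_partition m && allowed_ptn j m]|)%N.
Proof.
rewrite /c10 -sum1_card; under [RHS]eq_bigr => j _ do rewrite -sum1_card.
rewrite (eq_bigl (fun m => is_partition m && [exists j : 'I_n.+1, allowed_ptn j m]));
  last first.
  by move=> m; rewrite inE; case: (boolP (is_partition m)) => //= /exists_allowed->.
under [RHS]eq_bigr => j _ do
  rewrite (eq_bigl _ _ (fun m => in_set _ m)) big_mkcondr /=.
rewrite exchange_big /= big_mkcondr /=; apply: eq_bigr => m _.
case: existsP => [[j alj]|none].
  rewrite (bigD1 j) //= alj big1 // => i neij.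
  case: ifP => // ali; case/eqP: neij; apply: val_inj.
  by apply: (allowed_ptn_inj _ _ ali alj); apply: leq_ord.
by rewrite big1 // => j _; case: ifP => // alj; case: none; exists j.
Qed.

(** Expanding the product chooses one multiplicity for each part, that is an element of [ptn n], and
    the exponent of the resulting monomial is the sum of the parts. *)
Lemma card_partition_coef (R : comNzRingType) (A : nat -> nat -> bool) :
  (forall a, A 0%N a -> a = 0%N) ->
  #|[set m : ptn n | is_partition m && [forall k : 'I_n.+1, A k (m k)]]|%:R =
  (\prod_(k < n.+1) \sum_(a < n.+1 | A k a) 'X^(k * a))`_n :> R.
Proof.
move=> A0; rewrite bigA_distr_big_dep coef_sum -sum1_card natr_sum.
rewrite big_mkcond [RHS]big_mkcond /=; apply: eq_bigr => m _.
rewrite -expr_sum coefXn inE /is_partition.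
have -> : (m \in family (fun k a : 'I_n.+1 => A k a)) =
    [forall k : 'I_n.+1, A k (m k)] by [].
case: forallP => [al|_]; last by rewrite andbF.
rewrite (_ : mult m 0 = 0%N) /=; last by rewrite (multE m ord0); apply/A0/(al ord0).
by rewrite andbT [n == _]eq_sym; case: (_ == _).
Qed.

End Partitions.

(** * The generating function and its reduction modulo 2 *)

Section GeneratingFunction.
Variable F : fieldType.

(** Both truncations are compared with the one at [n.+1 + 4]. For k > 0 the terms with a > n have
    degree above [n]; for k = 0 only a = 0 survives. *)
Lemma sum_trunc_eqmX n k (A : pred nat) :
  (forall a, A a -> (a < 4)%N) -> (forall a, k = 0%N -> A a -> a = 0%N) ->
  eqmX n.+1 (\sum_(a < n.+1 | A a) 'X^(k * a) : {poly F})
            (\sum_(a < 4 | A a) 'X^(k * a)).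
Proof.
move=> A4 A0; rewrite -!(big_mkord A (fun a => 'X^(k * a))).
apply: (@eqmX_trans _ _ (\sum_(0 <= a < n.+1 + 4 | A a) 'X^(k * a))).
  rewrite (@big_cat_nat _ _ _ n.+1 0 (n.+1 + 4)) //=; last lia.
  rewrite -[X in eqmX _ X]addr0; apply: eqmXD; first exact: eqmX_refl.
  apply: eqmX_sym; rewrite big_nat_cond.
  rewrite -[X in eqmX _ _ X](@big1_eq _ 0 +%R nat (index_iota n.+1 (n.+1 + 4)) 
     (fun i => (n < i < n.+1 + 4)%N && A i)).
  apply: eqmX_sum => a /andP[lea Aa]; rewrite -[X in eqmX _ X]mul1r.
  have : k <> 0%N by move=> /A0/(_ Aa); lia.
  by move=> k0; apply: eqmX_Xn0; nia.
rewrite (@big_cat_nat _ _ _ 4 0 (n.+1 + 4)) //=; last lia.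
rewrite [X in _ + X]big1_seq ?addr0; first exact: eqmX_refl.
by move=> a /andP[/A4]; rewrite mem_index_iota; lia.
Qed.

(** For odd k up to [j], X^(2k) + X^(3k) is split as X^(2k) (1 + X^k), so that the odd parts
    contribute 1 + X^k whatever [j] is. *)
Definition allowed_factor (j k : nat) : {poly F} :=
  (if (k <= j)%N then 'X^(2 * k) else 1) *
  (if odd k then 1 + 'X^k else 1) *
  (if ~~ odd k && (j.*2 < k)%N then 1 + 'X^k else 1).

Lemma allowed_factor_eqmX n j k :
  eqmX n.+1 (\sum_(a < n.+1 | allowed j k a) 'X^(k * a)) (allowed_factor j k).
Proof.
apply: eqmX_trans (sum_trunc_eqmX _ _ _) _.
- move=> a; rewrite /allowed; do !case: ifP => _; lia.
- by move=> a ->; rewrite /allowed => /eqP.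
rewrite big_mkcond !big_ord_recl big_ord0 /= /bump /= /allowed /allowed_factor.
rewrite muln0 expr0.
have [->|k0] := posnP k; first by rewrite /= muln0 !addr0 !mulr1 eqmX_refl.
have [lekj|ltjk] := leqP k j.
  have -> : (j.*2 < k)%N = false by lia.
  case: (odd k); rewrite /= !(add0r, addr0, mulr1, mul1r) ?[(2 * k)%N]mulnC
    ?eqmX_refl //.
  by rewrite mulrDr mulr1 -exprD (_ : k * 3 = k * 2 + k)%N ?eqmX_refl //; lia.
case: (odd k); case: (_ < k)%N;
  by rewrite /= !(add0r, addr0, mulr1, mul1r) ?muln1 ?eqmX_refl.
Qed.

Lemma prod_nat_double (f : nat -> {poly F}) M :
  \prod_(0 <= k < M.*2) f k = \prod_(0 <= i < M) (f i.*2 * f i.*2.+1).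
Proof.
elim: M => [|M IHM]; first by rewrite !big_nil.
by rewrite doubleS !big_nat_recr //= IHM mulrA.
Qed.

Lemma prod_allowed_factor j K : (j <= K)%N ->
  \prod_(0 <= k < K.+1.*2) allowed_factor j k =
  \prod_(0 <= i < K.+1) (1 + 'X^(2 * i + 1)) *
  ('X^2 ^+ 'C(j.+1, 2) * \prod_(j <= i < K) (1 + 'X^2 ^+ i.+1)).
Proof.
move=> lejK; rewrite /allowed_factor !big_split /=.
rewrite [X in X * _]mulrC -mulrA; congr (_ * (_ * _)).
- rewrite prod_nat_double; apply: eq_bigr => i _.
  by rewrite /= odd_double /= mul1r addn1 mul2n.
- rewrite -big_mkcond /=.
  rewrite (eq_bigl (fun i => xpredT i && (i < j.+1)%N)); last first.
    by move=> i /=; rewrite ltnS.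
  rewrite -big_nat_widen; last lia.
  by rewrite -bin2_sum -exprM big_distrr /= expr_sum.
rewrite prod_nat_double.
rewrite (eq_bigr (fun i => if (j < i)%N then 1 + 'X^(2 * i) else 1)); last first.
  by move=> i _; rewrite /= odd_double /= mulr1 ltn_double mul2n.
rewrite -big_mkcond /=.
rewrite (eq_bigl (fun i => xpredT i && (j.+1 <= i)%N)) //.
rewrite -big_nat_widenl // big_add1 /=.
by apply: eq_bigr => i _; rewrite -exprM.
Qed.

Lemma prod_allowed_factor_eqmX n j K : (j <= n)%N -> (n <= K)%N ->
  eqmX n.+1 (\prod_(k < n.+1) allowed_factor j k)
            (\prod_(0 <= k < K.+1.*2) allowed_factor j k).
Proof.
move=> lejn lenK; rewrite -(big_mkord xpredT (allowed_factor j)).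
rewrite (@big_cat_nat _ _ _ n.+1 0 K.+1.*2) //=; last lia.
rewrite -[X in eqmX _ X]mulr1; apply: eqmXM; first exact: eqmX_refl.
apply: eqmX_sym; rewrite big_nat_cond.
rewrite -[X in eqmX _ _ X](@big1_eq _ 1 *%R nat (index_iota n.+1 K.+1.*2)
   (fun i => (n < i < K.+1.*2)%N && true)).
apply: eqmX_prod => k /andP[ltk _]; rewrite /allowed_factor.
have -> : (k <= j)%N = false by lia.
have eq1 : eqmX n.+1 (1 + 'X^k : {poly F}) 1.
  by rewrite /eqmX addrAC subrr add0r dvdp_exp2l //; lia.
by case: (odd k); case: (_ < k)%N; rewrite /= ?(mul1r, mulr1) ?eqmX_refl.
Qed.

Hypothesis charF2 : 2 \in [pchar F].

Lemma poly_opp_char2 (p : {poly F}) : - p = p.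
Proof. by apply: oppr_pchar2; rewrite pchar_poly. Qed.

Lemma c10_coef n :
  (c10 n)%:R =
  (\sum_(j < (n.+1.*2 + n.+1.*2).+1) 'X^(jtp_exp n.+1.*2 j) : {poly F})`_n.
Proof.
rewrite c10_sum_allowed natr_sum.
under eq_bigr => j _.
  rewrite (@card_partition_coef n F (allowed j)); last by move=> a /eqP.
  over.
rewrite -coef_sum; apply: (@eqmX_coef _ n.+1); last exact: ltnSn.
(* [L] is twice the precision [n.+1], as the triple product requires; [K.+1 = L.*2] lets the odd
   exponents in [O] split into [L] pairs 4i+1, 4i+3. *)
pose L := n.+1.*2; pose K := (L + L).-1.
have eqK : K.+1 = L.*2 by rewrite /K /L; lia.
pose O : {poly F} := \prod_(0 <= i < K.+1) (1 + 'X^(2 * i + 1)).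
apply: (@eqmX_trans _ _ (\sum_(j < n.+1) O *
  ('X^2 ^+ 'C(j.+1, 2) * \prod_(j <= i < K) (1 - 'X^2 ^+ i.+1)))).
  apply: eqmX_sum => j _.
  (* Characteristic 2 identifies the factors 1 + Q^i of the count with the factors 1 - Q^i of
     Euler's identity. *)
  under [X in _ * (_ * X)]eq_bigr => i _ do rewrite poly_opp_char2.
  have lejn := leq_ord j.
  rewrite -prod_allowed_factor; last by rewrite /K /L; lia.
  apply: eqmX_trans (prod_allowed_factor_eqmX lejn _); last by rewrite /K /L; lia.
  by apply: eqmX_prod => k _; exact: allowed_factor_eqmX.
rewrite -mulr_sumr.
apply: (@eqmX_trans _ _ (O * qpoch 'X^4 K)).
  apply: eqmXM; first exact: eqmX_refl.
  have -> : qpoch 'X^4 K = qpoch ('X^2 ^+ 2) K :> {poly F} by rewrite -exprM.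
  rewrite -prod_1D_qpoch; apply: sum_qpoch_tail_eqmX => //.
  by rewrite /K /L; lia.
have -> : O = \prod_(i < L) ((1 + 'X^(4 * i + 1)) * (1 + 'X^(4 * i + 3))).
  rewrite /O eqK prod_nat_double big_mkord; apply: eq_bigr => i _.
  by congr ((1 + 'X^_) * (1 + 'X^_)); lia.
rewrite mulrC; apply: triple_product_eqmX => //.
by rewrite /K /L; lia.
Qed.

End GeneratingFunction.

(** * Uniqueness of the representation and the parity of [c10] *)

Lemma jtp_expE M j :
  (jtp_exp M j)%:Z = 2 * (j%:Z - M%:Z) ^+ 2 + (j%:Z - M%:Z).
Proof.
rewrite /jtp_exp; case: (leqP M j) => leMj.
  by rewrite -[in RHS](subnK leMj); lia.
by rewrite -[in RHS](subnK (ltnW leMj)); nia.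
Qed.

(** The difference of two values factors as (a - b)(2(a + b) + 1), whose second factor is odd, hence
    nonzero. *)
Lemma jtp_exp_inj M : injective (jtp_exp M).
Proof.
move=> i j /(congr1 Posz); rewrite !jtp_expE.
set a := i%:Z - _; set b := j%:Z - _ => /eqP; rewrite -subr_eq0.
have -> : 2 * a ^+ 2 + a - (2 * b ^+ 2 + b) = (a - b) * (2 * (a + b) + 1) by ring.
by rewrite mulf_eq0 /a /b => /orP[]; lia.
Qed.

Theorem theorem11 (n : nat) :
  ((exists j : int, (n%:Z = 2 * j ^+ 2 + j)%R) -> odd (c10 n)) /\
  (~ (exists j : int, (n%:Z = 2 * j ^+ 2 + j)%R) -> ~~ odd (c10 n)).
Proof.
pose M := n.+1.*2.
(* By injectivity at most one monomial has degree [n], so the coefficient over the field with two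
   elements is 1 or 0. *)
have oddE : odd (c10 n) = [exists j : 'I_(M + M).+1, jtp_exp M j == n].
  have := c10_coef (pchar_Fp (isT : prime 2)) n.
  rewrite coef_sum; under eq_bigr => j _ do rewrite coefXn eq_sym.
  case: existsP => [[j /eqP ej]|none].
    rewrite (bigD1 j) //= -/M ej eqxx big1 => [|i neij].
      rewrite addr0 => /(congr1 val); rewrite /= !val_Fp_nat //.
      by rewrite !modn2; case: (odd _).
    by rewrite -ej (inj_eq (@jtp_exp_inj M)) val_eqE (negPf neij).
  rewrite big1 => [/(congr1 val)|j _].
    by rewrite /= val_Fp_nat // modn2; case: (odd _).
  by case: eqP => // /eqP ej; case: none; exists j.
rewrite oddE; split=> [[t eqt]|none].
  (* Since |t| is at most 2t^2 + t = n < M, the index t + M lies between 0 and 2M. *)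
  have t_bound : - n%:Z <= t <= n%:Z by nia.
  have t_abs : (absz (t + M%:Z))%:Z = t + M%:Z by rewrite /M; lia.
  have lt_t : (absz (t + M%:Z)%R < (M + M).+1)%N by rewrite /M; lia.
  apply/existsP; exists (Ordinal lt_t); apply/eqP.
  suff: (jtp_exp M (absz (t + M%:Z)))%:Z = n%:Z by case.
  by rewrite jtp_expE eqt t_abs addrK.
apply/existsP => -[j /eqP ej]; apply: none; exists (j%:Z - M%:Z).
by rewrite -ej jtp_expE.
Qed.
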